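(* Let $0\le a<1$ and let $f(z)=\frac{z+a}{1+za}$, a Moebius automorphism of the unit disk $\mathbb{U}$. Then for all points $z_1,z_2\in\mathbb{U}$ we have $$s_{\mathbb{U}}(f(z_1),f(z_2))\le (1+a)\,s_{\mathbb{U}}(z_1,z_2),$$ and the constant $1+a$ is the best possible (i.e. for the given $a$ it cannot be replaced by any smaller constant so that the inequality holds for all $z_1,z_2\in\mathbb{U}$).
   Context: $\mathbb{U}=\{z\in\mathbb{C}: |z|<1\}$ is the unit disk. The triangular ratio metric of a domain $D$ with boundary $\partial D$ is $$s_D(u,v)=\frac{|u-v|}{\inf_{w\in\partial D}(|u-w|+|w-v|)},\quad u,v\in D,$$ where $|\cdot|$ is the Euclidean distance. In particular $s_{\mathbb{U}}$ is this metric for $D=\mathbb{U}$, with $\partial\mathbb{U}$ the unit circle. *)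

(* Defs.v *)
From Stdlib Require Import Reals.
From Coquelicot Require Import Coquelicot.

Open Scope R_scope.

(* [locally] on [C] is the product topology of [R * R], i.e. the usual
   Euclidean topology of the plane. *)
Definition boundary (D : C -> Prop) (w : C) : Prop :=
  forall V : C -> Prop, locally w V ->
    (exists z, V z /\ D z) /\ (exists z, V z /\ ~ D z).

(* The set under the infimum is bounded below by 0, and it is nonempty as soon
   as [boundary D] is, so the infimum is then finite and [real] is harmless. *)
Definition triangular_ratio (D : C -> Prop) (u v : C) : R :=
  Cmod (u - v)%C /
  real (Glb_Rbar (fun r : R =>
    exists w : C, boundary D w /\ r = Cmod (u - w)%C + Cmod (w - v)%C)).

Definition unit_disk (z : C) : Prop := Cmod z < 1.

Definition moebius (a : R) (z : C) : C := ((z + RtoC a) / (1 + z * RtoC a))%C.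

(* Main.v *)
Require Import Defs.
From Stdlib Require Import Reals Lra.
From Coquelicot Require Import Coquelicot.

(** The proof pulls everything back to the circle of the source disk.  Write
    [E x = |x - z1| + |x - z2|], let [m] be the infimum of [E] over the unit
    circle, and let [c = |1 + a w|].  The identity
      [f u - f v = (1 - a^2) (u - v) / ((1 + a u) (1 + a v))]
    shows that the inequality amounts to
      [m c <= (1 + a) (|w - z1| |1 + a z2| + |w - z2| |1 + a z1|)]
    for each [w] on the circle ([inf_sum_le_moebius_sum]).  The weights on the
    right disappear when [w] is replaced by the point
      [zeta = w - a (w - z1) (w - z2) / (1 + a w)],
    since [(1 + a w) (zeta - z1) = (w - z1) (1 + a z2)] and symmetrically in
    [z1, z2]; what remains to prove is [m <= (1 + a) E zeta].

    Put [p = E zeta / 2] and [n = m / 2 - p]; the goal is [n <= a p], and one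
    may assume [n > 0].  The function [E] increases by at most [2 (1 - |x|)]
    when [x] is pushed radially to the circle, so [n > 0] forces
    [|zeta| <= 1 - n] ([sublevel_in_disk]).  The reflected point
    [zeta' = z1 + z2 - zeta] satisfies [E zeta' = E zeta], so it obeys the same
    bound.  Moreover [m <= 2], that is, [p <= 1 - n].  The definition of [zeta]
    can be rewritten as
      [w - zeta = a ((zeta - z1) (zeta - z2) - (w - zeta) zeta')].
    With [g = |w - zeta| >= n] and [|zeta - z1| |zeta - z2| <= p^2], this gives
    [g <= a (p^2 + g (1 - n))], whence [n <= a (p^2 + n (1 - n))].  As [a <= 1],
    it follows first that [n <= p], so that [n] is at least as far from [1/2]
    as [p] is, and [n (1 - n) <= p (1 - p)]; inserting this gives [n <= a p]
    ([deficit_le]).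

    For the constant, take [z1 = 0] and [z2 = t] real: the point [w = 1] serves
    both infima, and the quotient of the metric at [f 0, f t] by the metric at
    [0, t] is at least [(1 + a) (2 - t) / (2 - t (1 - a))], which tends to
    [1 + a] as [t] tends to [0]. *)

(** * Complex moduli *)

Lemma Cmod_sub_sym (u v : C) : Cmod (u - v) = Cmod (v - u).
Proof.
  rewrite <- Cmod_opp; f_equal; ring.
Qed.

Lemma Cmod_sub_le (u v : C) : Cmod (u - v) <= Cmod u + Cmod v.
Proof.
  unfold Cminus; rewrite <- (Cmod_opp v); apply Cmod_triangle.
Qed.

Lemma Cmod_le_of_sqr (u v : C) : Cmod u ^ 2 <= Cmod v ^ 2 -> Cmod u <= Cmod v.
Proof.
  intros H.
  pose proof (Cmod_ge_0 u); pose proof (Cmod_ge_0 v); nra.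
Qed.

Lemma polar_form (z : C) :
  exists w : C, Cmod w = 1 /\ z = (RtoC (Cmod z) * w)%C.
Proof.
  destruct (Ceq_dec z 0) as [-> | Hz].
  - exists 1%C; split; [apply Cmod_1 | rewrite Cmod_0; ring].
  - assert (Hr : RtoC (Cmod z) <> 0%C).
    { intros H; apply RtoC_inj in H; apply Hz, Cmod_eq_0, H. }
    exists (z / RtoC (Cmod z))%C; split.
    + rewrite Cmod_div, Cmod_R, Rabs_pos_eq by (apply Cmod_ge_0 || exact Hr).
      field; intros H; apply Hr; now rewrite H.
    + field; exact Hr.
Qed.

(** * The infimum over the circle *)

(** Radial projection to the circle: from inside it costs the distance to the
    circle, from outside it shortens the distance to every point of the
    disk. *)
Lemma radial_projection (x : C) :
  exists w : C, Cmod w = 1 /\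
    forall z : C, Cmod z <= 1 ->
      Cmod (w - z) <= Cmod (x - z) + Rmax 0 (1 - Cmod x).
Proof.
  destruct (polar_form x) as [w [Hw Hx]].
  exists w; split; [exact Hw | intros z Hz].
  pose proof (Cmod_ge_0 x) as Hr.
  destruct (Rle_dec (Cmod x) 1) as [Hin | Hout].
  - rewrite Rmax_right by lra.
    assert (Hd : Cmod (w - x) = 1 - Cmod x).
    { rewrite Hx at 1.
      replace (w - RtoC (Cmod x) * w)%C with (RtoC (1 - Cmod x) * w)%C
        by (rewrite RtoC_minus; ring).
      rewrite Cmod_mult, Hw, Cmod_R, Rabs_pos_eq by lra; ring. }
    replace (w - z)%C with ((w - x) + (x - z))%C by ring.
    pose proof (Cmod_triangle (w - x) (x - z)); lra.
  - rewrite Rmax_left, Rplus_0_r by lra.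
    apply Cmod_le_of_sqr.
    assert (Hw2 : Cmod w ^ 2 = 1) by (rewrite Hw; ring).
    assert (Hz2 : Cmod z ^ 2 <= 1) by (pose proof (Cmod_ge_0 z); nra).
    rewrite Hx.
    set (r := Cmod x) in *; clearbody r; clear Hx.
    rewrite !Cmod2_alt in *.
    destruct w as [w1 w2], z as [y1 y2]; simpl in *.
    assert (Hs : 2 * (w1 * y1 + w2 * y2) <= 2)
      by (pose proof (pow2_ge_0 (w1 - y1)); pose proof (pow2_ge_0 (w2 - y2)); nra).
    (* The difference of the two squares is (r - 1) (r + 1 - 2 <w, z>). *)
    assert (0 <= (r - 1) * (r + 1 - 2 * (w1 * y1 + w2 * y2)))
      by (apply Rmult_le_pos; lra).
    nra.
Qed.

(** The sublevel set of [E] at a height below [m] is an ellipse which stays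
    inside the disk, at a distance of half the difference of heights. *)
Lemma sublevel_in_disk (z1 z2 x : C) (m : R) :
  Cmod z1 <= 1 -> Cmod z2 <= 1 ->
  (forall w, Cmod w = 1 -> m <= Cmod (w - z1) + Cmod (w - z2)) ->
  Cmod (x - z1) + Cmod (x - z2) < m ->
  Cmod x <= 1 - (m - (Cmod (x - z1) + Cmod (x - z2))) / 2.
Proof.
  intros H1 H2 Hm Hlt.
  destruct (radial_projection x) as [w [Hw Hp]].
  pose proof (Hm w Hw); pose proof (Hp z1 H1); pose proof (Hp z2 H2).
  unfold Rmax in *; destruct (Rle_dec 0 (1 - Cmod x)); lra.
Qed.

(** The point of the circle nearest to the larger of [z1, z2] is at distance
    at most [1 - |z1|] from it and [1 + |z2|] from the other. *)
Lemma inf_sum_le_2 (z1 z2 : C) (m : R) :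
  Cmod z1 <= 1 -> Cmod z2 <= 1 ->
  (forall w, Cmod w = 1 -> m <= Cmod (w - z1) + Cmod (w - z2)) -> m <= 2.
Proof.
  assert (Hle : forall u v, Cmod u <= 1 -> Cmod v <= Cmod u ->
    (forall w, Cmod w = 1 -> m <= Cmod (w - u) + Cmod (w - v)) -> m <= 2).
  { intros u v Hu Hv Hm.
    destruct (radial_projection u) as [w [Hw Hp]].
    pose proof (Hm w Hw); pose proof (Hp u Hu).
    pose proof (Cmod_sub_le w v).
    replace (u - u)%C with (RtoC 0) in * by ring; rewrite Cmod_0 in *.
    rewrite Rmax_right in * by lra; lra. }
  intros H1 H2 Hm.
  destruct (Rle_dec (Cmod z2) (Cmod z1)).
  - now apply (Hle z1 z2).
  - apply (Hle z2 z1); [lra | lra |].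
    intros w Hw; rewrite Rplus_comm; now apply Hm.
Qed.

(** * The main inequality *)

(** [l1, l2, g, k] stand for [|zeta - z1|, |zeta - z2|, |w - zeta|, |zeta'|].
    The hypothesis on [g] gives [n <= a (p^2 + n (1 - n))] for
    [p = (l1 + l2) / 2], since [g (1 - a (1 - n)) <= a p^2] and the factor
    [1 - a (1 - n)] is nonnegative. *)
Lemma deficit_le (a l1 l2 g k n : R) :
  0 <= a <= 1 -> 0 <= l1 -> 0 <= l2 -> 0 < n ->
  n <= 1 - (l1 + l2) / 2 -> n <= g -> k <= 1 - n ->
  g <= a * (l1 * l2 + g * k) ->
  n <= a * ((l1 + l2) / 2).
Proof.
  intros Ha H1 H2 Hn Hp Hg Hk Hrel.
  assert (Hq : l1 * l2 <= ((l1 + l2) / 2) ^ 2)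
    by (pose proof (pow2_ge_0 (l1 - l2)); nra).
  assert (Hp0 : 0 <= (l1 + l2) / 2) by lra.
  set (p := (l1 + l2) / 2) in *; clearbody p.
  set (q := l1 * l2) in *; clearbody q.
  assert (Hgk : g * k <= g * (1 - n)) by (apply Rmult_le_compat_l; lra).
  assert (Hg' : g <= a * (p ^ 2 + g * (1 - n))).
  { apply Rle_trans with (1 := Hrel), Rmult_le_compat_l; lra. }
  assert (Hf : 0 <= 1 - a * (1 - n)) by nra.
  assert (Hn' : n <= a * (p ^ 2 + n * (1 - n))).
  { assert (n * (1 - a * (1 - n)) <= g * (1 - a * (1 - n)))
      by (apply Rmult_le_compat_r; lra).
    nra. }
  assert (Hnp : n <= p).
  { assert (0 <= p ^ 2 + n * (1 - n)) by nra.
    assert (a * (p ^ 2 + n * (1 - n)) <= 1 * (p ^ 2 + n * (1 - n)))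
      by (apply Rmult_le_compat_r; lra).
    nra. }
  (* n <= p <= 1 - n puts p closer to 1/2 than n. *)
  assert (0 <= (p - n) * (1 - p - n)) by (apply Rmult_le_pos; lra).
  apply Rle_trans with (1 := Hn'), Rmult_le_compat_l; nra.
Qed.

Lemma one_plus_mult_neq_0 (a : R) (z : C) :
  -1 < a < 1 -> Cmod z <= 1 -> (1 + z * RtoC a)%C <> 0%C.
Proof.
  intros Ha Hz H.
  assert (Hm : Cmod (z * RtoC a) = 1).
  { replace (z * RtoC a)%C with (- (1))%C; [apply Cmod_m1 |].
    replace (z * RtoC a)%C with ((1 + z * RtoC a) - 1)%C by ring.
    rewrite H; ring. }
  rewrite Cmod_mult, Cmod_R in Hm.
  pose proof (Cmod_ge_0 z); pose proof (Rabs_pos a).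
  assert (Rabs a < 1) by (apply Rabs_def1; lra).
  nra.
Qed.

Lemma inf_sum_le_moebius_sum (a : R) (z1 z2 w : C) (m : R) :
  0 <= a < 1 -> Cmod z1 <= 1 -> Cmod z2 <= 1 -> Cmod w = 1 ->
  (forall x, Cmod x = 1 -> m <= Cmod (x - z1) + Cmod (x - z2)) ->
  m * Cmod (1 + w * RtoC a) <=
    (1 + a) * (Cmod (w - z1) * Cmod (1 + z2 * RtoC a) +
               Cmod (w - z2) * Cmod (1 + z1 * RtoC a)).
Proof.
  intros Ha H1 H2 Hw Hm.
  assert (Hc : (1 + w * RtoC a)%C <> 0%C)
    by (apply one_plus_mult_neq_0; lra).
  pose (zeta := (w - RtoC a * (w - z1) * (w - z2) / (1 + w * RtoC a))%C).
  pose (zeta' := (z1 + z2 - zeta)%C).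
  assert (E1 : ((w - z1) * (1 + z2 * RtoC a))%C
               = ((1 + w * RtoC a) * (zeta - z1))%C)
    by (unfold zeta; field; exact Hc).
  assert (E2 : ((w - z2) * (1 + z1 * RtoC a))%C
               = ((1 + w * RtoC a) * (zeta - z2))%C)
    by (unfold zeta; field; exact Hc).
  assert (E3 : (w - zeta)%C
               = (RtoC a * ((zeta - z1) * (zeta - z2) - (w - zeta) * zeta'))%C)
    by (unfold zeta', zeta; field; exact Hc).
  rewrite <- !Cmod_mult, E1, E2, !Cmod_mult.
  enough (m <= (1 + a) * (Cmod (zeta - z1) + Cmod (zeta - z2)))
    by (pose proof (Cmod_ge_0 (1 + w * RtoC a)); nra).
  pose proof (Cmod_ge_0 (zeta - z1)) as P1.
  pose proof (Cmod_ge_0 (zeta - z2)) as P2.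
  destruct (Rle_dec m (Cmod (zeta - z1) + Cmod (zeta - z2))) as [|Hlt];
    [nra | apply Rnot_le_lt in Hlt].
  assert (R1 : Cmod (zeta' - z1) = Cmod (zeta - z2))
    by (rewrite Cmod_sub_sym; f_equal; unfold zeta'; ring).
  assert (R2 : Cmod (zeta' - z2) = Cmod (zeta - z1))
    by (rewrite Cmod_sub_sym; f_equal; unfold zeta'; ring).
  pose proof (sublevel_in_disk z1 z2 zeta m H1 H2 Hm Hlt) as Hz.
  assert (Hz' : Cmod zeta' <= 1 - (m - (Cmod (zeta - z1) + Cmod (zeta - z2))) / 2).
  { rewrite (Rplus_comm (Cmod (zeta - z1))), <- R1, <- R2.
    apply sublevel_in_disk; auto; lra. }
  pose proof (inf_sum_le_2 z1 z2 m H1 H2 Hm) as Hm2.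
  assert (Hg : 1 <= Cmod (w - zeta) + Cmod zeta).
  { rewrite <- Hw; replace w with ((w - zeta) + zeta)%C at 1 by ring.
    apply Cmod_triangle. }
  assert (Hrel : Cmod (w - zeta) <=
    a * (Cmod (zeta - z1) * Cmod (zeta - z2) + Cmod (w - zeta) * Cmod zeta')).
  { rewrite E3 at 1.
    rewrite Cmod_mult, Cmod_R, Rabs_pos_eq by lra.
    apply Rmult_le_compat_l; [lra |].
    rewrite <- !Cmod_mult; apply Cmod_sub_le. }
  pose proof (deficit_le a (Cmod (zeta - z1)) (Cmod (zeta - z2))
    (Cmod (w - zeta)) (Cmod zeta')
    ((m - (Cmod (zeta - z1) + Cmod (zeta - z2))) / 2)).
  lra.
Qed.

(** * The triangular ratio metric of the disk *)

Lemma boundary_unit_disk (w : C) : boundary unit_disk w <-> Cmod w = 1.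
Proof.
  unfold unit_disk; split.
  - intros Hb.
    assert (Hnear : forall d : R, 0 < d -> locally w (fun z => Cmod (z - w) < d)).
    { intros d Hd.
      assert (Hs : 0 < sqrt 2) by (apply sqrt_lt_R0; lra).
      assert (He : 0 < d / sqrt 2) by (apply Rdiv_lt_0_compat; lra).
      exists (mkposreal _ He); intros z Hz.
      apply C_NormedModule_mixin_compat2 in Hz; simpl in Hz.
      replace (sqrt 2 * (d / sqrt 2)) with d in Hz by (field; lra).
      exact Hz. }
    destruct (Rtotal_order (Cmod w) 1) as [Hlt | [Heq | Hgt]]; [| exact Heq |].
    + destruct (Hb _ (Hnear (1 - Cmod w) ltac:(lra))) as [_ [z [Hz Hn]]].
      exfalso; apply Hn.
      replace z with ((z - w) + w)%C by ring.
      pose proof (Cmod_triangle (z - w) w); lra.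
    + destruct (Hb _ (Hnear (Cmod w - 1) ltac:(lra))) as [[z [Hz Hn]] _].
      pose proof (Cmod_sub_le z (z - w)) as H.
      replace (z - (z - w))%C with w in H by ring; lra.
  - intros Hw V [eps HV].
    pose proof (cond_pos eps) as He.
    split.
    + pose (t := Rmin (eps / 2) 1).
      assert (Ht : 0 < t /\ t <= eps / 2 /\ t <= 1).
      { unfold t; repeat split;
          [apply Rmin_pos; lra | apply Rmin_l | apply Rmin_r]. }
      exists (RtoC (1 - t) * w)%C; split.
      * apply HV, C_NormedModule_mixin_compat1.
        change (Cmod (RtoC (1 - t) * w - w)%C < eps).
        replace (RtoC (1 - t) * w - w)%C with (RtoC (- t) * w)%C
          by (rewrite RtoC_minus, RtoC_opp; ring).
        rewrite Cmod_mult, Hw, Cmod_R, Rabs_Ropp, Rabs_pos_eq by lra; lra.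
      * rewrite Cmod_mult, Hw, Cmod_R, Rabs_pos_eq by lra; lra.
    + exists w; split; [apply HV, ball_center | lra].
Qed.

(** The infimum is at least [(1 - |u|) + (1 - |v|)], so it is finite and
    positive; from here on only its two defining properties are used. *)
Lemma triangular_ratio_unit_disk (u v : C) :
  unit_disk u -> unit_disk v ->
  exists m : R, 0 < m /\
    (forall w, Cmod w = 1 -> m <= Cmod (w - u) + Cmod (w - v)) /\
    (forall b, (forall w, Cmod w = 1 -> b <= Cmod (w - u) + Cmod (w - v)) ->
       b <= m) /\
    triangular_ratio unit_disk u v = Cmod (u - v) / m.
Proof.
  intros Hu Hv; unfold triangular_ratio; unfold unit_disk in Hu, Hv.
  match goal with |- context [Glb_Rbar ?X] => set (S := X) end.
  destruct (Glb_Rbar_correct S) as [Hlb Hglb].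
  assert (HS : forall w, Cmod w = 1 -> S (Cmod (w - u) + Cmod (w - v))).
  { intros w Hw; exists w; split; [now apply boundary_unit_disk |].
    now rewrite (Cmod_sub_sym w u). }
  assert (Hb : forall b : R,
    (forall w, Cmod w = 1 -> b <= Cmod (w - u) + Cmod (w - v)) ->
    Rbar_le b (Glb_Rbar S)).
  { intros b H; apply Hglb; intros r [w [Hw ->]]; simpl.
    rewrite (Cmod_sub_sym u w); apply H; now apply boundary_unit_disk. }
  assert (Hpos : Rbar_le (1 - Cmod u + (1 - Cmod v)) (Glb_Rbar S)).
  { apply Hb; intros w Hw.
    assert (Hd : forall z, 1 <= Cmod (w - z) + Cmod z).
    { intros z; rewrite <- Hw; replace w with ((w - z) + z)%C at 1 by ring.
      apply Cmod_triangle. }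
    pose proof (Hd u); pose proof (Hd v); lra. }
  pose proof (Hlb _ (HS _ Cmod_1)) as Hfin.
  destruct (Glb_Rbar S) as [m | |]; simpl in Hpos, Hfin; try contradiction.
  exists m; split; [lra |]; split; [| split; [exact Hb | reflexivity]].
  intros w Hw; exact (Hlb _ (HS w Hw)).
Qed.

(** * Moebius maps *)

(** For [|a| < 1], comparing signs shows that [moebius a] preserves both the
    circle and the disk. *)
Lemma moebius_sqr_identity (a : R) (z : C) :
  Cmod (1 + z * RtoC a) ^ 2 - Cmod (z + RtoC a) ^ 2
  = (1 - a ^ 2) * (1 - Cmod z ^ 2).
Proof.
  rewrite !Cmod2_alt; destruct z as [x y]; simpl; ring.
Qed.

Lemma moebius_circle (a : R) (z : C) :
  -1 < a < 1 -> Cmod z = 1 -> Cmod (moebius a z) = 1.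
Proof.
  intros Ha Hz.
  assert (Hc : (1 + z * RtoC a)%C <> 0%C) by (apply one_plus_mult_neq_0; lra).
  pose proof (moebius_sqr_identity a z) as H; rewrite Hz in H.
  apply Cmod_gt_0 in Hc as Hc'.
  unfold moebius; rewrite Cmod_div by exact Hc.
  replace (Cmod (z + RtoC a)) with (Cmod (1 + z * RtoC a)).
  - field; lra.
  - pose proof (Cmod_ge_0 (z + RtoC a)); nra.
Qed.

Lemma moebius_unit_disk (a : R) (z : C) :
  -1 < a < 1 -> unit_disk z -> unit_disk (moebius a z).
Proof.
  unfold unit_disk; intros Ha Hz.
  assert (Hc : (1 + z * RtoC a)%C <> 0%C) by (apply one_plus_mult_neq_0; lra).
  pose proof (moebius_sqr_identity a z) as H.
  apply Cmod_gt_0 in Hc as Hc'.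
  unfold moebius; rewrite Cmod_div by exact Hc.
  apply Rlt_div_l; [exact Hc' |].
  pose proof (Cmod_ge_0 (z + RtoC a)); pose proof (Cmod_ge_0 z).
  assert (0 < (1 - a ^ 2) * (1 - Cmod z ^ 2)) by (apply Rmult_lt_0_compat; nra).
  nra.
Qed.

Lemma moebius_surj_circle (a : R) (W : C) :
  -1 < a < 1 -> Cmod W = 1 -> exists w, Cmod w = 1 /\ moebius a w = W.
Proof.
  intros Ha HW.
  exists (moebius (- a) W); split; [apply moebius_circle; lra |].
  assert (Hc : (1 + W * RtoC (- a))%C <> 0%C) by (apply one_plus_mult_neq_0; lra).
  assert (Ha2 : (1 - RtoC a * RtoC a)%C <> 0%C).
  { rewrite <- RtoC_mult, <- RtoC_minus; intros H; apply RtoC_inj in H; nra. }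
  unfold moebius in *; rewrite RtoC_opp in *.
  (* The composite has denominator (1 - a^2) / (1 - a W). *)
  field; split; [exact Hc |].
  replace (1 + W * - RtoC a + (W + - RtoC a) * RtoC a)%C
    with (1 - RtoC a * RtoC a)%C by ring.
  exact Ha2.
Qed.

Lemma moebius_dist (a : R) (u v : C) :
  -1 < a < 1 -> Cmod u <= 1 -> Cmod v <= 1 ->
  Cmod (moebius a u - moebius a v) =
  (1 - a ^ 2) * Cmod (u - v) / (Cmod (1 + u * RtoC a) * Cmod (1 + v * RtoC a)).
Proof.
  intros Ha Hu Hv.
  pose proof (one_plus_mult_neq_0 a u Ha Hu) as Nu.
  pose proof (one_plus_mult_neq_0 a v Ha Hv) as Nv.
  replace (moebius a u - moebius a v)%C
    with (RtoC (1 - a ^ 2) * (u - v)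
          / ((1 + u * RtoC a) * (1 + v * RtoC a)))%C.
  - rewrite Cmod_div by (now apply Cmult_neq_0).
    rewrite !Cmod_mult, Cmod_R, Rabs_pos_eq by nra; reflexivity.
  - unfold moebius; replace (a ^ 2) with (a * a) by ring.
    rewrite RtoC_minus, RtoC_mult; field; split; assumption.
Qed.

(** * The Lipschitz bound and its sharpness *)

Lemma triangular_ratio_moebius_le (a : R) (z1 z2 : C) :
  0 <= a < 1 -> unit_disk z1 -> unit_disk z2 ->
  triangular_ratio unit_disk (moebius a z1) (moebius a z2)
    <= (1 + a) * triangular_ratio unit_disk z1 z2.
Proof.
  intros Ha H1 H2.
  assert (Ha' : -1 < a < 1) by lra.
  destruct (triangular_ratio_unit_disk z1 z2 H1 H2) as [m [Hm [Hlb [_ ->]]]].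
  destruct (triangular_ratio_unit_disk (moebius a z1) (moebius a z2))
    as [m' [Hm' [_ [Hglb ->]]]]; try now apply moebius_unit_disk.
  unfold unit_disk in *; apply Rlt_le in H1, H2.
  pose proof (one_plus_mult_neq_0 a z1 Ha' H1) as N1.
  pose proof (one_plus_mult_neq_0 a z2 Ha' H2) as N2.
  apply Cmod_gt_0 in N1, N2.
  rewrite moebius_dist by assumption.
  set (A1 := Cmod (1 + z1 * RtoC a)) in *.
  set (A2 := Cmod (1 + z2 * RtoC a)) in *.
  assert (HA : 0 < A1 * A2) by (apply Rmult_lt_0_compat; assumption).
  assert (Hk : (1 - a ^ 2) * m / ((1 + a) * (A1 * A2)) <= m').
  { apply Hglb; intros W HW.
    destruct (moebius_surj_circle a W Ha' HW) as [w [Hw <-]].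
    pose proof (inf_sum_le_moebius_sum a z1 z2 w m Ha H1 H2 Hw Hlb) as Hmain.
    rewrite !moebius_dist by (assumption || lra).
    fold A1 A2 in Hmain |- *.
    assert (Nw : (1 + w * RtoC a)%C <> 0%C) by (apply one_plus_mult_neq_0; lra).
    apply Cmod_gt_0 in Nw.
    set (c := Cmod (1 + w * RtoC a)) in *.
    apply Rminus_le_0.
    match goal with |- 0 <= ?X => replace X with
      ((1 - a ^ 2) / ((1 + a) * (A1 * A2) * c) *
       ((1 + a) * (Cmod (w - z1) * A2 + Cmod (w - z2) * A1) - m * c))
      by (field; repeat split; lra) end.
    apply Rmult_le_pos; [| lra].
    apply Rlt_le, Rdiv_lt_0_compat; [nra |].
    apply Rmult_lt_0_compat; [apply Rmult_lt_0_compat |]; lra. }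
  apply Rle_div_l in Hk; [| apply Rmult_lt_0_compat; lra].
  pose proof (Cmod_ge_0 (z1 - z2)) as Hd.
  apply Rminus_le_0.
  match goal with |- 0 <= ?X => replace X with
    (Cmod (z1 - z2) / (m * m' * (A1 * A2)) *
     (m' * ((1 + a) * (A1 * A2)) - (1 - a ^ 2) * m))
    by (field; repeat split; lra) end.
  apply Rmult_le_pos; [| lra].
  apply Rdiv_le_0_compat; [exact Hd |].
  apply Rmult_lt_0_compat; [apply Rmult_lt_0_compat |]; lra.
Qed.

(** The bound on [s(0, t)] is an equality, attained at the boundary point
    [1]. *)
Lemma triangular_ratio_0_le (t : R) :
  0 < t < 1 -> triangular_ratio unit_disk 0 (RtoC t) <= t / (2 - t).
Proof.
  intros Ht.
  assert (Ht' : Cmod (RtoC t) = t) by (rewrite Cmod_R; apply Rabs_pos_eq; lra).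
  destruct (triangular_ratio_unit_disk 0 (RtoC t)) as [m [Hm [_ [Hglb ->]]]].
  - unfold unit_disk; rewrite Cmod_0; lra.
  - unfold unit_disk; lra.
  - assert (H : 2 - t <= m).
    { apply Hglb; intros w Hw.
      pose proof (Cmod_triangle (w - RtoC t) (RtoC t)) as Hd.
      replace (w - RtoC t + RtoC t)%C with w in Hd by ring.
      replace (w - 0)%C with w by ring; lra. }
    rewrite Cmod_sub_sym; replace (RtoC t - 0)%C with (RtoC t) by ring.
    rewrite Ht'.
    unfold Rdiv; apply Rmult_le_compat_l; [lra |].
    apply Rinv_le_contravar; lra.
Qed.

Lemma le_triangular_ratio_moebius_0 (a t : R) :
  0 <= a < 1 -> 0 < t < 1 ->
  (1 + a) * t / (2 - t * (1 - a)) <=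
  triangular_ratio unit_disk (moebius a 0) (moebius a (RtoC t)).
Proof.
  intros Ha Ht.
  assert (Ha' : -1 < a < 1) by lra.
  assert (Ht' : Cmod (RtoC t) = t) by (rewrite Cmod_R; apply Rabs_pos_eq; lra).
  assert (Hta : 0 <= t * a) by (apply Rmult_le_pos; lra).
  assert (F1 : moebius a (RtoC 1) = RtoC 1).
  { unfold moebius; rewrite <- RtoC_mult, <- !RtoC_plus, <- RtoC_div by lra.
    f_equal; field; lra. }
  destruct (triangular_ratio_unit_disk (moebius a 0) (moebius a (RtoC t)))
    as [m [Hm [Hlb [_ ->]]]].
  - apply moebius_unit_disk; [exact Ha' |]; unfold unit_disk; rewrite Cmod_0; lra.
  - apply moebius_unit_disk; [exact Ha' |]; unfold unit_disk; lra.
  - specialize (Hlb 1 Cmod_1).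
    rewrite <- F1 in Hlb.
    rewrite !moebius_dist in * by (rewrite ?Cmod_0, ?Cmod_1; lra).
    rewrite <- !RtoC_mult, <- !RtoC_plus, <- !RtoC_minus, !Cmod_R in *.
    rewrite (Rabs_left (0 - t)), !Rabs_pos_eq in * by nra.
    replace ((1 - a ^ 2) * (1 - 0) / ((1 + 1 * a) * (1 + 0 * a)) +
             (1 - a ^ 2) * (1 - t) / ((1 + 1 * a) * (1 + t * a)))
      with ((1 - a) * (2 - t * (1 - a)) / (1 + t * a)) in Hlb
      by (field; lra).
    apply Rle_div_r in Hlb; [| lra].
    replace ((1 - a ^ 2) * - (0 - t) / ((1 + 0 * a) * (1 + t * a)) / m)
      with ((1 - a ^ 2) * t / (m * (1 + t * a))) by (field; lra).
    assert (Hden : 0 < 2 - t * (1 - a)) by nra.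
    replace ((1 + a) * t / (2 - t * (1 - a)))
      with ((1 - a ^ 2) * t / ((1 - a) * (2 - t * (1 - a)))) by (field; lra).
    unfold Rdiv; apply Rmult_le_compat_l; [apply Rmult_le_pos; nra |].
    apply Rinv_le_contravar; [apply Rmult_lt_0_compat; lra | exact Hlb].
Qed.

Theorem theorem1 (a : R) (ha : 0 <= a < 1) :
  (forall z1 z2 : C, unit_disk z1 -> unit_disk z2 ->
     triangular_ratio unit_disk (moebius a z1) (moebius a z2)
       <= (1 + a) * triangular_ratio unit_disk z1 z2) /\
  (forall c : R,
     (forall z1 z2 : C, unit_disk z1 -> unit_disk z2 ->
        triangular_ratio unit_disk (moebius a z1) (moebius a z2)
          <= c * triangular_ratio unit_disk z1 z2) ->
     1 + a <= c).
Proof.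
  split.
  - intros z1 z2; now apply triangular_ratio_moebius_le.
  - intros c Hc.
    assert (H : forall t, 0 < t < 1 ->
      0 < c /\ (1 + a) * (2 - t) <= c * (2 - t * (1 - a))).
    { intros t Ht.
      assert (Ht' : Cmod (RtoC t) = t)
        by (rewrite Cmod_R; apply Rabs_pos_eq; lra).
      assert (H0 : unit_disk 0) by (unfold unit_disk; rewrite Cmod_0; lra).
      assert (H1 : unit_disk (RtoC t)) by (unfold unit_disk; lra).
      specialize (Hc 0%C (RtoC t) H0 H1).
      pose proof (triangular_ratio_0_le t Ht) as Hup.
      pose proof (le_triangular_ratio_moebius_0 a t ha Ht) as Hlow.
      assert (Hden : 0 < 2 - t * (1 - a)) by nra.
      assert (Hlow0 : 0 < (1 + a) * t / (2 - t * (1 - a)))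
        by (apply Rdiv_lt_0_compat; nra).
      destruct (triangular_ratio_unit_disk 0 (RtoC t) H0 H1)
        as [m [Hm [_ [_ Hs]]]].
      assert (Hs0 : 0 <= triangular_ratio unit_disk 0 (RtoC t)).
      { rewrite Hs; apply Rdiv_le_0_compat; [apply Cmod_ge_0 | exact Hm]. }
      assert (Hc0 : 0 < c) by nra.
      split; [exact Hc0 |].
      assert (Hq : (1 + a) * t / (2 - t * (1 - a)) <= c * (t / (2 - t))) by nra.
      apply (Rle_div_l _ _ _ Hden) in Hq.
      replace (c * (t / (2 - t)) * (2 - t * (1 - a)))
        with (c * t * (2 - t * (1 - a)) / (2 - t)) in Hq by (field; lra).
      apply Rle_div_r in Hq; [| lra].
      apply Rmult_le_reg_l with t; lra. }
    destruct (Rle_dec (1 + a) c) as [Hle | Hgt]; [exact Hle | exfalso].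
    apply Rnot_le_lt in Hgt.
    destruct (H (1 / 2) ltac:(lra)) as [Hc0 _].
    (* For c > 0 the inequality implies 1 + a - c <= t, which this t violates. *)
    destruct (H ((1 + a - c) / 2) ltac:(lra)) as [_ Hl].
    set (t := (1 + a - c) / 2) in *.
    assert (Ht : 0 < t) by (unfold t; lra).
    assert (Hd : 2 * (1 + a - c) = 4 * t) by (unfold t; field).
    assert (0 <= t * (c * (1 - a)))
      by (repeat apply Rmult_le_pos; lra).
    clearbody t; nra.
Qed.
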